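(* Let $F(x)=\frac12x^TAx+b^Tx$, where $A\in\mathbb R^{n\times n}$ is symmetric with zero diagonal and $A\ge0$, $b\ge0$. Let $\mathcal M$ be a matroid on $[n]$ with rank $r$ and minimum circuit size $c\ge3$, and let $P_{\mathcal M}$ be its matroid polytope. If $x^*\in P_{\mathcal M}$, then there is an independent set $I$ of $\mathcal M$ such that \[ \Big(3+\frac{2r}{c-2}\Big)F(\mathbbm 1_I)\ge F(x^* ). \]
   Context: $P_{\mathcal M}$ is the convex hull of characteristic vectors $\mathbbm1_S$ of independent sets $S$ of $\mathcal M$. *)

(* Defs.v *)
From HB Require Import structures.
From mathcomp Require Import all_boot all_order all_algebra.
From mathcomp Require Import reals constructive_ereal.

Set Implicit Arguments.
Unset Strict Implicit.
Unset Printing Implicit Defensive.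

Import Order.TTheory GRing.Theory Num.Theory.

Local Open Scope ring_scope.

Record matroid (T : finType) := Matroid {
  indep : pred {set T};
  indep0 : indep set0;
  indepS : forall X Y : {set T}, X \subset Y -> indep Y -> indep X;
  indep_aug : forall X Y : {set T}, indep X -> indep Y -> (#|X| < #|Y|)%N ->
    exists2 e : T, e \in Y :\: X & indep (e |: X)
}.

Definition matroid_rank (T : finType) (M : matroid T) : nat :=
  \max_(S : {set T} | indep M S) #|S|.

Definition circuit (T : finType) (M : matroid T) (C : {set T}) : bool :=
  minset (fun S => ~~ indep M S) C.

(* Extended-real valued: by the usual convention, the minimum over no circuits
   (when every set is independent) is +oo. *)
Definition min_circuit_size (R : realType) (T : finType) (M : matroid T)
    : \bar R :=
  \big[Order.min/+oo%E]_(C : {set T} | circuit M C) ((#|C|)%:R%:E).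

Definition indicator (R : realType) (n : nat) (S : {set 'I_n}) : 'cV[R]_n :=
  \col_i (i \in S)%:R.
Arguments indicator R {n} S.

Definition convex_hull (R : realType) (E : lmodType R) (A : E -> Prop) : E -> Prop :=
  fun x => exists (k : nat) (w : 'I_k -> R) (v : 'I_k -> E),
    [/\ forall i, 0 <= w i, \sum_i w i = 1, forall i, A (v i)
      & x = \sum_i w i *: v i].

Definition matroid_polytope (R : realType) (n : nat) (M : matroid 'I_n)
    : 'cV[R]_n -> Prop :=
  convex_hull
    (fun x => exists2 S : {set 'I_n}, indep M S & x = indicator R S).
Arguments matroid_polytope R {n} M.

Definition quad_obj (R : realType) (n : nat) (A : 'M[R]_n) (b x : 'cV[R]_n)
    : R :=
  2^-1 * (x^T *m A *m x) 0 0 + (b^T *m x) 0 0.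

(* Main.v *)
(** Expanding [x*] as a convex combination of independent sets [S_i] reduces the
    claim to a bound on [e(S, T) + b(S) + b(T)] for two independent sets, where
    [e(S, T)] is the sum of [A] over [S x T].  Write [OPT] for the best value at
    an independent set and [k = floor((c-1)/2)].  A block [X] of at most [k]
    elements of [S \ T] extends inside [X U T] to an independent set [Z] missing
    at most [k] elements of [T]; then [X U (T \ Z)] has fewer than [c] elements,
    so it is independent too, and [e(X, T) <= F(Z) + F(X U (T \ Z)) <= 2 OPT].
    At most [2r/(c-2) + 1] blocks cover [S \ T], and
    [e(S /\ T, T) <= e(T, T) <= 2 OPT]. *)

Require Import Defs.
From HB Require Import structures.
From mathcomp Require Import all_boot all_order all_algebra.
From mathcomp Require Import reals constructive_ereal.
From mathcomp Require Import lra zify.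

Set Implicit Arguments.
Unset Strict Implicit.
Unset Printing Implicit Defensive.

Import Order.TTheory GRing.Theory Num.Theory.

Local Open Scope ring_scope.

(** * Independent sets and circuits *)

Lemma subset_of_card (T : finType) (S : {set T}) (k : nat) :
  (k <= #|S|)%N -> exists2 X : {set T}, X \subset S & #|X| = k.
Proof.
move=> lekS; exists [set x in take k (enum S)].
  by apply/subsetP => x; rewrite inE => /mem_take; rewrite mem_enum.
rewrite cardsE; have /card_uniqP -> := take_uniq k (enum_uniq S).
by rewrite size_takel // -cardE.
Qed.

Lemma indep_card_le_rank (T : finType) (M : matroid T) (S : {set T}) :
  indep M S -> (#|S| <= matroid_rank M)%N.
Proof. by move=> iS; apply: (@leq_bigmax_cond _ (indep M) (fun S => #|S|)). Qed.

(** Repeated augmentation of [X] by elements of [Y], by induction on a bound for the deficit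
    [#|Y| - #|X|]. *)
Lemma indep_extend (T : finType) (M : matroid T) (X Y : {set T}) :
  indep M X -> indep M Y ->
  exists Z : {set T},
    [/\ indep M Z, X \subset Z, Z \subset X :|: Y & (#|Y| <= #|Z|)%N].
Proof.
move: {2}(#|Y| - #|X|)%N (leqnn (#|Y| - #|X|)) => d.
elim: d X => [|d IHd] X led iX iY.
  by exists X; split; rewrite ?subsetUl //; lia.
have [leYX|ltXY] := leqP #|Y| #|X|.
  by exists X; split; rewrite ?subsetUl.
have [e /setDP[eY eX] ieX] := indep_aug iX iY ltXY.
have [|Z [iZ /subUsetP[eZ XZ] ZXY leYZ]] := IHd (e |: X) _ ieX iY.
  by rewrite cardsU1 eX; lia.
exists Z; split=> //; apply: subset_trans ZXY _.
by rewrite -setUA subUset sub1set inE eY orbT /=.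
Qed.

(** A dependent set contains a circuit, which is no larger than the set. *)
Lemma indep_of_small (R : realType) (T : finType) (M : matroid T)
    (X : {set T}) :
  (#|X|%:R%:E < min_circuit_size R M)%E -> indep M X.
Proof.
apply: contraLR => dX; have [C cC CX] := @minset_exists _ (fun S => ~~ indep M S) X dX.
rewrite -leNgt; apply: (@bigmin_inf _ _ _ _ C _ _ _ cC).
by rewrite lee_fin ler_nat subset_leq_card.
Qed.

(** Separates the case without circuits, so that otherwise the division by [c - 2] takes place among
    real numbers. *)
Lemma min_circuit_size_cases (R : realType) (T : finType) (M : matroid T) :
  min_circuit_size R M = +oo%E \/
  exists m : nat, min_circuit_size R M = m%:R%:E.
Proof.
rewrite /min_circuit_size.
elim/big_ind: _ => [|x y|C _]; [by left| |by right; exists #|C|].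
by move=> Px Py; rewrite minEle; case: ifP.
Qed.

(** * Sums of [A] and [b] over sets, and their bounds *)

Definition cross_weight (R : realType) (n : nat) (A : 'M[R]_n)
  (S T : {set 'I_n}) : R := \sum_(i in S) \sum_(j in T) A i j.

Definition set_weight (R : realType) (n : nat) (b : 'cV[R]_n)
  (S : {set 'I_n}) : R := \sum_(i in S) b i 0.

Lemma ler_sum_subset (R : realType) (T : finType) (f : T -> R)
    (S S' : {set T}) :
  (forall i, 0 <= f i) -> S \subset S' ->
  \sum_(i in S) f i <= \sum_(i in S') f i.
Proof.
move=> f_ge0 sSS'; rewrite [leRHS](big_setID S) /= (setIidPr sSS').
by rewrite lerDl sumr_ge0.
Qed.

Lemma set_weight_ge0 (R : realType) (n : nat) (b : 'cV[R]_n) (S : {set 'I_n}) :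
  (forall i, 0 <= b i 0) -> 0 <= set_weight b S.
Proof. by move=> b_ge0; apply: sumr_ge0. Qed.

Lemma cross_weight_ge0 (R : realType) (n : nat) (A : 'M[R]_n)
    (S T : {set 'I_n}) :
  (forall i j, 0 <= A i j) -> 0 <= cross_weight A S T.
Proof. by move=> A_ge0; do 2!apply: sumr_ge0 => ? _. Qed.

Lemma cross_weight_sub (R : realType) (n : nat) (A : 'M[R]_n)
    (S S' T T' : {set 'I_n}) :
  (forall i j, 0 <= A i j) -> S \subset S' -> T \subset T' ->
  cross_weight A S T <= cross_weight A S' T'.
Proof.
move=> A_ge0 sS sT; apply: le_trans (ler_sum_subset _ sS); last first.
  by move=> i; apply: sumr_ge0.
by apply: ler_sum => i _; apply: ler_sum_subset.
Qed.

Lemma cross_weightC (R : realType) (n : nat) (A : 'M[R]_n)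
    (S T : {set 'I_n}) :
  A^T = A -> cross_weight A S T = cross_weight A T S.
Proof.
move=> A_sym; rewrite /cross_weight exchange_big /=.
by apply: eq_bigr => i _; apply: eq_bigr => j _; rewrite -[in LHS]A_sym mxE.
Qed.

Lemma cross_weight_setIDl (R : realType) (n : nat) (A : 'M[R]_n)
    (X S T : {set 'I_n}) :
  cross_weight A S T = cross_weight A (S :&: X) T + cross_weight A (S :\: X) T.
Proof. by rewrite {1}/cross_weight (big_setID X). Qed.

(** The disjoint rectangles [X] x [Y] and [Y] x [X] both lie in [U] x [U] and, by symmetry, have
    equal weight. *)
Lemma cross_weight_disjoint (R : realType) (n : nat) (A : 'M[R]_n)
    (X Y U : {set 'I_n}) :
  A^T = A -> (forall i j, 0 <= A i j) -> [disjoint X & Y] ->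
  X \subset U -> Y \subset U -> 2 * cross_weight A X Y <= cross_weight A U U.
Proof.
move=> A_sym A_ge0 XY XU YU.
rewrite (cross_weight_setIDl A X U) (setIidPr XU) mulr2n mulrDl mul1r.
apply: lerD; first exact: cross_weight_sub.
rewrite (cross_weightC X) //; apply: cross_weight_sub => //.
by rewrite subsetD YU disjoint_sym.
Qed.

Lemma cross_weight_indicator (R : realType) (n : nat) (A : 'M[R]_n)
    (S T : {set 'I_n}) :
  ((indicator R S)^T *m A *m indicator R T) 0 0 = cross_weight A S T.
Proof.
rewrite -mulmxA mxE /cross_weight [RHS]big_mkcond; apply: eq_bigr => i _.
rewrite !mxE; case: (i \in S); rewrite ?mul0r ?mul1r // [RHS]big_mkcond.
by apply: eq_bigr => j _; rewrite mxE; case: (j \in T); rewrite ?mulr1 ?mulr0.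
Qed.

Lemma set_weight_indicator (R : realType) (n : nat) (b : 'cV[R]_n)
    (S : {set 'I_n}) :
  (b^T *m indicator R S) 0 0 = set_weight b S.
Proof.
rewrite mxE /set_weight [RHS]big_mkcond; apply: eq_bigr => i _.
by rewrite !mxE; case: (i \in S); rewrite ?mulr1 ?mulr0.
Qed.

Lemma quad_obj_indicator (R : realType) (n : nat) (A : 'M[R]_n) (b : 'cV[R]_n)
    (S : {set 'I_n}) :
  quad_obj A b (indicator R S) =
    2^-1 * cross_weight A S S + set_weight b S.
Proof.
by rewrite /quad_obj cross_weight_indicator set_weight_indicator.
Qed.

(** Induction on the number [m] of blocks: each block peeled off [S] costs at most [2 * V]. *)
Lemma cross_weight_blocks (R : realType) (n : nat) (A : 'M[R]_n)
    (M : matroid 'I_n) (k m : nat) (V : R) (S T : {set 'I_n}) :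
  A^T = A -> (forall i j, 0 <= A i j) ->
  (forall X : {set 'I_n}, (#|X| <= k.*2)%N -> indep M X) ->
  (forall X : {set 'I_n}, indep M X -> cross_weight A X X <= 2 * V) ->
  indep M S -> indep M T -> [disjoint S & T] -> (#|S| <= m * k)%N ->
  cross_weight A S T <= 2 * V * m%:R.
Proof.
move=> A_sym A_ge0 small optV iS iT; elim: m S iS => [|m IHm] S iS dST leS.
  have /eqP/cards0_eq -> : #|S| == 0%N by lia.
  by rewrite /cross_weight big_set0 mulr0.
(* The minimum allows for a last block with fewer than [k] elements. *)
have [|X XS cX] := @subset_of_card _ S (minn k #|S|); first exact: geq_minr.
have iX := indepS XS iS.
have dXT : [disjoint X & T] by apply: disjointWl XS dST.
have [Z [iZ XZ ZXT leTZ]] := indep_extend iX iT.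
(* [Z] has at least [#|T|] elements, and all but the at most [k] in [X] lie in [T]. *)
have cY : (#|T :\: Z| <= k)%N.
  have := subset_leq_card (_ : Z :\: X \subset T :&: Z).
  rewrite cardsDS // => /(_ _); have := cardsID Z T.
  have -> : Z :\: X \subset T :&: Z.
    rewrite subsetI subsetDl andbT; apply/subsetP => x /setDP[xZ xX].
    by have := subsetP ZXT x xZ; rewrite inE (negPf xX).
  by move=> ? /(_ isT) ?; lia.
have iXY : indep M (X :|: (T :\: Z)).
  by apply: small; apply: leq_trans (leq_card_setU _ _) _; lia.
have eZ : 2 * cross_weight A X (T :&: Z) <= 2 * V.
  apply: le_trans (optV _ iZ); apply: cross_weight_disjoint; rewrite ?subsetIr //.
  by apply: disjointWr dXT; apply: subsetIl.
have eXY : 2 * cross_weight A X (T :\: Z) <= 2 * V.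
  apply: le_trans (optV _ iXY).
  apply: cross_weight_disjoint; rewrite ?subsetUl ?subsetUr //.
  by apply: disjointWr dXT; apply: subsetDl.
have eS : cross_weight A (S :\: X) T <= 2 * V * m%:R.
  apply: IHm; first by apply: indepS iS; apply: subsetDl.
    by apply: disjointWl dST; apply: subsetDl.
  by rewrite cardsDS // cX; lia.
have eXT : cross_weight A X T =
    cross_weight A X (T :&: Z) + cross_weight A X (T :\: Z).
  by rewrite ![cross_weight A X _]cross_weightC // -cross_weight_setIDl.
rewrite (cross_weight_setIDl A X) (setIidPr XS) eXT -(natr1 m) mulrDr mulr1; lra.
Qed.

(** The products [w i * w j] sum to 1, so F(x) is a weighted average over pairs of vertices. The
    linear term is split evenly between the two vertices, whence the form of the hypothesis. *)
Lemma quad_obj_convex_hull_le (R : realType) (n : nat) (A : 'M[R]_n)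
    (b : 'cV[R]_n) (M : matroid 'I_n) (K : R) (x : 'cV[R]_n) :
  matroid_polytope R M x ->
  (forall S T, indep M S -> indep M T ->
    cross_weight A S T + set_weight b S + set_weight b T <= 2 * K) ->
  quad_obj A b x <= K.
Proof.
move=> [p [w [v [w_ge0 w1 vI ->]]]] hK.
suff -> : quad_obj A b (\sum_i w i *: v i) = \sum_i \sum_j w i * w j *
    (2^-1 * ((v i)^T *m A *m v j) 0 0 + 2^-1 * (b^T *m v i) 0 0
     + 2^-1 * (b^T *m v j) 0 0).
  have -> : K = \sum_i \sum_j w i * w j * K.
    under eq_bigr do rewrite -mulr_suml -mulr_sumr w1 mulr1.
    by rewrite -mulr_suml w1 mul1r.
  apply: ler_sum => i _; apply: ler_sum => j _.
  apply: ler_wpM2l; first exact: mulr_ge0.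
  have [S iS ->] := vI i; have [T iT ->] := vI j.
  rewrite cross_weight_indicator !set_weight_indicator.
  have := hK S T iS iT; lra.
have lin : (b^T *m \sum_i w i *: v i) 0 0 = \sum_i w i * (b^T *m v i) 0 0.
  rewrite mulmx_sumr summxE; apply: eq_bigr => i _.
  by rewrite -scalemxAr mxE.
have quad : ((\sum_i w i *: v i)^T *m A *m \sum_i w i *: v i) 0 0 =
    \sum_i \sum_j w i * w j * ((v i)^T *m A *m v j) 0 0.
  have -> : (\sum_i w i *: v i)^T = \sum_i w i *: (v i)^T.
    by rewrite raddf_sum; apply: eq_bigr => i _; rewrite /= linearZ.
  rewrite -mulmxA mulmx_suml summxE; apply: eq_bigr => i _.
  rewrite mulmxA mulmx_sumr summxE; apply: eq_bigr => j _.
  by rewrite -!scalemxAl -scalemxAr scalerA mxE.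
rewrite /quad_obj lin quad mulr_sumr.
under [RHS]eq_bigr do
  (under eq_bigr do rewrite !mulrDr; rewrite !big_split /=).
rewrite !big_split /= -addrA; congr (_ + _).
  apply: eq_bigr => i _; rewrite mulr_sumr.
  by apply: eq_bigr => j _; rewrite mulrCA.
rewrite [X in _ = _ + X]exchange_big /=.
(* The free index sums out to 1. *)
have split u : \sum_i \sum_j w i * w j * (2^-1 * u i) = 2^-1 * \sum_i w i * u i.
  rewrite mulr_sumr; apply: eq_bigr => i _.
  by rewrite -mulr_suml -mulr_sumr w1 mulr1 mulrCA.
have -> : \sum_j \sum_i w i * w j * (2^-1 * (b^T *m v j) 0 0) =
    2^-1 * \sum_i w i * (b^T *m v i) 0 0.
  rewrite -split; apply: eq_bigr => j _; apply: eq_bigr => i _.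
  by rewrite (mulrC (w i)).
rewrite (split (fun i => (b^T *m v i) 0 0)); lra.
Qed.

Theorem theorem5 (R : realType) (n : nat) (A : 'M[R]_n) (b : 'cV[R]_n)
    (M : matroid 'I_n) (r : nat) (c : \bar R) (xstar : 'cV[R]_n)
    (A_sym : A^T = A)
    (A_diag0 : forall i, A i i = 0)
    (A_ge0 : forall i j, 0 <= A i j)
    (b_ge0 : forall i, 0 <= b i 0)
    (r_def : r = matroid_rank M)
    (c_def : c = min_circuit_size R M)
    (c_ge3 : (3%:E <= c)%E)
    (x_in : matroid_polytope R M xstar) :
  exists I : {set 'I_n},
    indep M I /\
    ((3%:E + (2 * r%:R)%:E / (c - 2%:E)) * (quad_obj A b (indicator R I))%:E
      >= (quad_obj A b xstar)%:E)%E.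
Proof.
pose F (I : {set 'I_n}) := quad_obj A b (indicator R I).
have [I iI maxI] := @arg_maxP _ _ _ set0 (indep M) F (indep0 M).
exists I; split=> //; rewrite -/(F I); set V := F I in maxI *.
have optV X : indep M X -> 2^-1 * cross_weight A X X + set_weight b X <= V.
  by move=> iX; rewrite -quad_obj_indicator; apply: maxI.
have b0 S := @set_weight_ge0 _ _ b S b_ge0.
have e0 S T := @cross_weight_ge0 _ _ A S T A_ge0.
have V0 : 0 <= V.
  by have := optV _ iI; have := b0 I; have := e0 I I; lra.
have [coo|[m cm]] := min_circuit_size_cases R M.
  (* Here the quotient is 0 and the factor is 3. The union of [S] and [T] is itself independent and
     bounds the whole sum by [2 * V]. *)
  have all_indep X : indep M X by apply: (@indep_of_small R); rewrite coo ltry.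
  rewrite c_def coo /= invey mule0 adde0 -EFinM lee_fin.
  apply: quad_obj_convex_hull_le x_in _ => S T _ _.
  have sS := subsetUl S T; have sT := subsetUr S T.
  have := optV _ (all_indep (S :|: T)).
  have := @cross_weight_sub _ _ A _ _ _ _ A_ge0 sS sT.
  have := @ler_sum_subset R _ (fun i => b i 0) _ _ b_ge0 sS.
  have := @ler_sum_subset R _ (fun i => b i 0) _ _ b_ge0 sT.
  rewrite -!/(set_weight b _); lra.
have m3 : (3 <= m)%N by move: c_ge3; rewrite c_def cm lee_fin ler_nat.
have m3R : 3 <= m%:R :> R by rewrite ler_nat.
have m2 : m%:R - 2 != 0 :> R by rewrite gt_eqF //; lra.
rewrite c_def cm -EFinB inver (negPf m2) -EFinM lee_fin.
apply: quad_obj_convex_hull_le x_in _ => S T iS iT.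
(* [k] is the largest integer with 2k < m, so sets of size 2k are independent; [q] blocks suffice
   because r < qk. *)
pose k := (m.-1)./2; pose q := (r %/ k).+1.
have k_gt0 : (0 < k)%N by rewrite /k; lia.
have eST : cross_weight A (S :\: T) T <= 2 * V * q%:R.
  apply: (@cross_weight_blocks _ _ _ M k) => //.
  - move=> X leX; apply: (@indep_of_small R); rewrite cm lte_fin ltr_nat.
    by rewrite /k in leX; lia.
  - by move=> X iX; have := optV _ iX; have := b0 X; lra.
  - by apply: indepS iS; apply: subsetDl.
  - by rewrite -setI_eq0 setIDAC -setIDA setDv setI0.
  - apply: leq_trans (subset_leq_card (subsetDl S T)) _.
    apply: leq_trans (indep_card_le_rank iS) _.
    by rewrite -r_def ltnW // ltn_ceil.
have eT : cross_weight A (S :&: T) T <= cross_weight A T T.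
  by apply: cross_weight_sub; rewrite ?subsetIr.
(* Halving [m.-1] rounds down by at most 1/2, so m - 2 <= 2k and r/k <= 2r/(m - 2). *)
have leq : q%:R <= 2 * r%:R / (m%:R - 2) + 1 :> R.
  rewrite -(natr1 (r %/ k)) lerD2r ler_pdivlMr; last lra.
  have mk : m%:R - 2 <= 2 * k%:R :> R.
    by rewrite lerBlDr -natrM -natrD ler_nat /k; lia.
  have rk : (r %/ k)%:R * k%:R <= r%:R :> R by rewrite -natrM ler_nat leq_divM.
  apply: le_trans (ler_wpM2l _ mk) _ => //; lra.
have Vq := ler_wpM2l V0 leq.
(* With z = 2r/(m - 2), the blocks give at most 2V(z + 1), e(T, T) + b(T) at most 2V, and b(S) at
   most V. The total (5 + 2z)V is within 2(3 + z)V. *)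
have := optV _ iS; have := optV _ iT; have := e0 S S; have := b0 T.
rewrite (cross_weight_setIDl A T S T).
move: (2 * r%:R / _) Vq => z Vq; lra.
Qed.
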